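(* Let $n\ge 1$ be an integer, let $P(x,y)=y\bar{x}\bar{y}^2+ix\bar{x}^2\bar{y}$ for $x,y\in\mathbb{C}$, and let $$Q(z_1,z_2,\ldots,z_{2n-1},z_{2n})=\sum_{k=1}^n P(z_{2k-1},z_{2k}),\qquad (z_1,\ldots,z_{2n})\in\mathbb{C}^{2n}.$$ Regard $S^{4n-1}$ as the unit sphere in $\mathbb{C}^{2n}$. Then the embedding $F\colon S^{4n-1}\to\mathbb{C}^{2n+1}$ defined by $$F(z_1,z_2,\ldots,z_{2n-1},z_{2n})=\big(z_1,z_2,\ldots,z_{2n-1},z_{2n},\,Q(z_1,z_2,\ldots,z_{2n-1},z_{2n})\big)$$ is a CR regular embedding.
   Context: Let $F\colon M^d\to\mathbb{C}^N$ be a smooth embedding of a smooth $d$-manifold $M^d$, and let $J$ be the standard complex structure on $\mathbb{C}^N$ (multiplication by $i$ on tangent vectors). For every $x\in M^d$ one has $\dim_{\mathbb{C}}\big(dF_x(T_xM^d)\cap J\,dF_x(T_xM^d)\big)\ge d-N$. The embedding $F$ is called a CR regular embedding if equality holds, that is, $\dim_{\mathbb{C}}\big(dF_x(T_xM^d)\cap J\,dF_x(T_xM^d)\big)=d-N$, for each point $x\in M^d$. (When $d=N$, a CR regular embedding is called totally real.) Here $d=4n-1$ and $N=2n+1$. *)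

(* Defs.v *)
From HB Require Import structures.
From mathcomp Require Import all_boot all_order all_algebra.
From mathcomp Require Import complex.
From mathcomp Require Import all_classical all_reals all_analysis.

Set Implicit Arguments.
Unset Strict Implicit.
Unset Printing Implicit Defensive.

Import Order.TTheory GRing.Theory Num.Theory.
Import numFieldNormedType.Exports.

Local Open Scope classical_set_scope.
Local Open Scope ring_scope.

Section SmoothMaps.
Variable R : realType.

(* [Ck k U f]: [f] is of class C^k on the open set [U].  In finite dimension
   continuity of [x |-> 'd f x] amounts to continuity of [x |-> 'd f x v] for
   every [v], so no topology on spaces of linear maps is needed. *)
Fixpoint Ck (V W : normedModType R) (k : nat) (U : set V) (f : V -> W) : Prop :=
  if k is k'.+1 then
    (forall x, U x -> differentiable f x) /\
    (forall v, Ck k' U (fun x => 'd f x v))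
  else forall x, U x -> {for x, continuous f}.

Definition smooth_on (V W : normedModType R) (U : set V) (f : V -> W) : Prop :=
  forall k, Ck k U f.

Variable m : nat.
Implicit Types (M : set 'rV[R]_m) (x v : 'rV[R]_m).

(* Smooth manifolds are taken embedded in some R^m: near each of its points
   [M] is the zero set of a submersion onto R^(m - d). *)
Definition smooth_submanifold (d : nat) M : Prop :=
  exists2 c : nat, (d + c)%N = m &
  forall x, M x -> exists (U : set 'rV[R]_m) (g : 'rV[R]_m -> 'rV[R]_c),
    [/\ open U, U x, smooth_on U g,
        (forall y, U y -> (M y <-> g y = 0)) &
        (forall y, U y -> forall w, exists v, 'd g y v = w)].

Definition smooth_curve M x (gamma : R -> 'rV[R]_m) : Prop :=
  gamma 0 = x /\
  exists I : set R,
    [/\ open I, I 0, @smooth_on R^o _ I gamma & forall t, I t -> M (gamma t)].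

Definition tangent_space M x : set 'rV[R]_m :=
  [set v | exists2 gamma, smooth_curve M x gamma & 'D_1 gamma (0 : R^o) = v].

Variable q : nat.
Implicit Types (F : 'rV[R]_m -> 'rV[R]_q).

(* Only the values of [F] on [M] matter here and below. *)
Definition smooth_map M F : Prop :=
  forall x, M x -> exists (U : set 'rV[R]_m) (G : 'rV[R]_m -> 'rV[R]_q),
    [/\ open U, U x, smooth_on U G & forall y, U y -> M y -> F y = G y].

(* [differential M F x v w]: dF_x(v) = w.  If [F] is smooth on [M] this is the
   graph of a linear map on [tangent_space M x]. *)
Definition differential M F x v (w : 'rV[R]_q) : Prop :=
  exists2 gamma, smooth_curve M x gamma &
    'D_1 gamma (0 : R^o) = v /\ 'D_1 (F \o gamma) (0 : R^o) = w.

Definition tangent_image M F x : set 'rV[R]_q :=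
  [set w | exists2 v, tangent_space M x v & differential M F x v w].

Definition immersion M F : Prop :=
  forall x v, M x -> tangent_space M x v -> differential M F x v 0 -> v = 0.

Definition smooth_embedding M F : Prop :=
  [/\ smooth_map M F, immersion M F &
      exists2 G : 'rV[R]_q -> 'rV[R]_m,
        {within F @` M, continuous G} & forall x, M x -> G (F x) = x].

End SmoothMaps.

Section CRRegular.
Variable R : realType.
Local Open Scope complex_scope.

(* C^N is identified with R^(N + N) by (x_j + i y_j)_j <-> (x, y). *)
Definition realify (N : nat) (z : 'rV[R[i]]_N) : 'rV[R]_(N + N) :=
  row_mx (map_mx (@complex.Re R) z) (map_mx (@complex.Im R) z).

Definition complexify (N : nat) (v : 'rV[R]_(N + N)) : 'rV[R[i]]_N :=
  \row_j (lsubmx v 0 j +i* rsubmx v 0 j).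

Lemma realifyK N : cancel (@realify N) (@complexify N).
Proof.
move=> z; apply/rowP => j; rewrite !mxE /= (unsplitK (inl j)) (unsplitK (inr j)).
by rewrite !mxE; case: (z 0 j).
Qed.

Lemma complexifyK N : cancel (@complexify N) (@realify N).
Proof.
move=> v; rewrite -[RHS]hsubmxK; congr row_mx; by apply/rowP => j; rewrite !mxE.
Qed.

Definition has_complex_dim (N : nat) (W : set 'rV[R[i]]_N) (k : nat) : Prop :=
  exists2 V : {vspace 'rV[R[i]]_N}, W = [set w | w \in V] & \dim V = k.

Definition J (N : nat) (w : 'rV[R[i]]_N) : 'rV[R[i]]_N := 'i *: w.

Definition complex_tangent_image (m N : nat) (M : set 'rV[R]_m)
    (F : 'rV[R]_m -> 'rV[R[i]]_N) (x : 'rV[R]_m) : set 'rV[R[i]]_N :=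
  @complexify N @` tangent_image M (@realify N \o F) x.

Definition CR_regular_embedding (m N d : nat) (M : set 'rV[R]_m)
    (F : 'rV[R]_m -> 'rV[R[i]]_N) : Prop :=
  [/\ smooth_submanifold d M,
      smooth_embedding M (@realify N \o F) &
      forall x, M x ->
        let T := complex_tangent_image M F x in
        exists2 k : nat, has_complex_dim (T `&` (@J N @` T)) k &
          k%:Z = d%:Z - N%:Z].

Definition unit_sphere (m : nat) : set 'rV[R[i]]_m :=
  [set z | \sum_(j < m) `|z 0 j| ^+ 2 = 1].

Definition P (x y : R[i]) : R[i] :=
  y * x^* * (y^*) ^+ 2 + 'i * x * (x^*) ^+ 2 * y^*.

Lemma fst_index_subproof n (k : 'I_n) : (2 * k < 2 * n)%N.
Proof. by rewrite ltn_pmul2l. Qed.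

Lemma snd_index_subproof n (k : 'I_n) : ((2 * k).+1 < 2 * n)%N.
Proof. by rewrite !mul2n ltn_Sdouble. Qed.

(* Coordinates are numbered from 0, hence the pairs (2k, 2k + 1). *)
Definition Q (n : nat) (z : 'rV[R[i]]_(2 * n)) : R[i] :=
  \sum_(k < n) P (z 0 (Ordinal (fst_index_subproof k)))
                 (z 0 (Ordinal (snd_index_subproof k))).

Definition graphQ (n : nat) (z : 'rV[R[i]]_(2 * n)) : 'rV[R[i]]_(2 * n + 1) :=
  row_mx z (const_mx (Q z)).

End CRRegular.

(* Main.v *)
From HB Require Import structures.
Require Import Defs.
From mathcomp Require Import all_boot all_order all_algebra.
From mathcomp Require Import complex.
From mathcomp Require Import all_classical all_reals all_analysis.
From mathcomp Require Import ring lra zify.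

Set Implicit Arguments.
Unset Strict Implicit.
Unset Printing Implicit Defensive.

Import Order.TTheory GRing.Theory Num.Theory.
Import numFieldNormedType.Exports.

Local Open Scope classical_set_scope.
Local Open Scope ring_scope.

(* The image of dF_z consists of the (u, dQ(u) + dbarQ(u)) with
   Re <z, u> = 0, where dQ is C-linear and dbarQ is C-antilinear.  Comparing it
   with its image under i, the maximal complex subspace is the set of the
   (u, dQ(u)) with <z, u> = 0 and dbarQ(u) = 0.  Its dimension is 2n - 2 as soon
   as the vectors z and dQ/dzbar are C-independent, and this holds at every
   z <> 0: for a pair (x, y) <> 0, with a = |x|^2 and b = |y|^2,
     x P_ybar - y P_xbar = b (2 a - b) + i a (a - 2 b)
   is zero only if a = b = 0. *)

(** * Polynomial maps are smooth *)

Lemma diff_coord (R : realType) m (i : 'I_m) (x v : 'rV[R]_m) :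
  'd (fun y : 'rV[R]_m => y 0 i) x v = v 0 i.
Proof.
pose h : 'rV[R]_m -> R := fun y => y 0 i.
have lh : linear h by move=> a y z; rewrite /h !mxE.
pose hL := GRing.isLinear.Build _ _ _ _ h lh.
pose H : {linear 'rV[R]_m -> R} := HB.pack h hL.
rewrite -/h -[h]/(H : _ -> _) diff_lin //; exact: coord_continuous.
Qed.

Section PolynomialMaps.
Variables (R : realType) (m : nat).
Implicit Types (f g : 'rV[R]_m -> R) (x v : 'rV[R]_m).

(** A semantic class of real polynomial functions: its members are differentiable, and it is stable
    under differentiation in a fixed direction, so smoothness of every order follows by
    induction. *)
Inductive polyfun : ('rV[R]_m -> R) -> Prop :=
| polyfun_cst c : polyfun (cst c)
| polyfun_coord i : polyfun (fun x => x 0 i)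
| polyfunD f g : polyfun f -> polyfun g -> polyfun (f \+ g)
| polyfunM f g : polyfun f -> polyfun g -> polyfun (f \* g).

Lemma polyfun_sum n (f : 'I_n -> 'rV[R]_m -> R) :
  (forall i, polyfun (f i)) -> polyfun (fun x => \sum_(i < n) f i x).
Proof.
elim: n f => [|n IHn] f pf.
  rewrite (_ : (fun _ => _) = cst 0); first exact: polyfun_cst.
  by apply/funext => x; rewrite big_ord0.
rewrite (_ : (fun _ => _) =
  (fun x => \sum_(i < n) f (widen_ord (leqnSn n) i) x) \+ f ord_max).
  by constructor => //; apply: IHn.
by apply/funext => x; rewrite big_ord_recr.
Qed.

Lemma polyfunN f : polyfun f -> polyfun (fun x => - f x).
Proof.
move=> pf; rewrite (_ : (fun _ => _) = cst (-1) \* f); first by do ?constructor.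
by apply/funext => x /=; rewrite mulN1r.
Qed.

Lemma polyfun_differentiable f x : polyfun f -> differentiable f x.
Proof.
elim => {f} [c|i|f g _ df _ dg|f g _ df _ dg].
- exact: differentiable_cst.
- exact: differentiable_coord.
- exact: differentiableD.
- exact: differentiableM.
Qed.

Lemma polyfun_diff f v : polyfun f -> polyfun (fun x => 'd f x v).
Proof.
elim => {f} [c|i|f g pf df pg dg|f g pf df pg dg].
- rewrite (_ : (fun _ => _) = cst 0); first exact: polyfun_cst.
  by apply/funext => x; rewrite diff_cst.
- rewrite (_ : (fun _ => _) = cst (v 0 i)); first exact: polyfun_cst.
  by apply/funext => x; rewrite diff_coord.
- rewrite (_ : (fun _ => _) = (fun x => 'd f x v) \+ (fun x => 'd g x v)).
    exact: polyfunD.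
  apply/funext => x; have dfx := polyfun_differentiable x pf.
  have dgx := polyfun_differentiable x pg.
  exact: (congr1 (fun h : 'rV[R]_m -> R => h v) (diffD dfx dgx)).
- rewrite (_ : (fun _ => _) =
    (f \* (fun x => 'd g x v)) \+ (g \* (fun x => 'd f x v))).
    by do 2?constructor.
  apply/funext => x; have dfx := polyfun_differentiable x pf.
  have dgx := polyfun_differentiable x pg.
  exact: (congr1 (fun h : 'rV[R]_m -> R => h v) (diffM dfx dgx)).
Qed.

Definition polymap q (F : 'rV[R]_m -> 'rV[R]_q) : Prop :=
  forall j, polyfun (fun x => F x 0 j).

Variable q : nat.
Implicit Type F : 'rV[R]_m -> 'rV[R]_q.

(** Reduces differentiability of a vector-valued map to that of its scalar components. *)
Lemma rV_sumE F : F = \sum_(j < q) (fun x => F x 0 j *: delta_mx 0 j).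
Proof.
apply/funext => x; rewrite fct_sumE /= {1}(row_sum_delta (F x)).
by apply: eq_bigr.
Qed.

Lemma polymap_differentiable F x : polymap F -> differentiable F x.
Proof.
move=> pF; rewrite (rV_sumE F); apply: differentiable_sum => j.
apply: differentiableZl; exact: polyfun_differentiable.
Qed.

Lemma diff_row F x v j : differentiable F x ->
  'd F x v 0 j = 'd (fun y => F y 0 j) x v.
Proof.
move=> dF; have dc := @differentiable_coord R 1 q (F x) 0 j.
have := congr1 (fun h : 'rV[R]_m -> R => h v) (diff_comp dF dc).
by rewrite /= diff_coord => ->.
Qed.

Lemma polymap_diff F v : polymap F -> polymap (fun x => 'd F x v).
Proof.
move=> pF j; rewrite (_ : (fun _ => _) = (fun x => 'd (fun y => F y 0 j) x v)).
  exact: polyfun_diff.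
by apply/funext => x; rewrite diff_row //; exact: polymap_differentiable.
Qed.

(** The induction on the order runs over all [F] at once, since the next order concerns the maps
    ['d F x v], which are again polynomial in [x]. *)
Lemma polymap_smooth F U : polymap F -> smooth_on U F.
Proof.
move=> pF k; elim: k F pF => [|k IHk] F pF /=.
  move=> x _; apply: differentiable_continuous.
  exact: polymap_differentiable.
split=> [x _|v]; first exact: polymap_differentiable.
by apply: IHk; exact: polymap_diff.
Qed.

End PolynomialMaps.

(** * Ellipses, used as curves on the sphere *)

Section Ellipse.
Variables (R : realType) (V : normedModType R).

(** A family closed under differentiation at fixed frequency [c], so one derivative formula gives
    smoothness. It contains the great circles of the sphere and, for [c = 0], the constant
    curves. *)
Definition ellipse (c : R) (a b : V) : R^o -> V :=
  fun t => cos (c * t) *: a + sin (c * t) *: b.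

Lemma ellipse_is_derive (c : R) (a b : V) (t : R^o) :
  is_derive t (1 : R^o) (ellipse c a b) (ellipse c (c *: b) (- c *: a) t).
Proof.
have dl : is_derive t (1 : R^o) (fun s : R^o => c * s : R^o) c.
  have := @is_deriveZ R R^o R^o id c t 1 1 _.
  rewrite /GRing.scale /= mulr1; apply; exact: is_derive_id.
have dc : is_derive t (1 : R^o) (fun s : R^o => cos (c * s) : R^o)
    (- c * sin (c * t)).
  have := @is_derive1_comp R cos (fun s => c * s) t _ _ (is_derive_cos _) dl.
  by rewrite mulNr mulrC -mulNr.
have ds : is_derive t (1 : R^o) (fun s : R^o => sin (c * s) : R^o)
    (c * cos (c * t)).
  have := @is_derive1_comp R sin (fun s => c * s) t _ _ (is_derive_sin _) dl.
  by rewrite mulrC.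
have Dc : differentiable (fun s : R^o => cos (c * s) : R^o) t.
  by apply/derivable1_diffP.
have Ds : differentiable (fun s : R^o => sin (c * s) : R^o) t.
  by apply/derivable1_diffP.
have De : differentiable (ellipse c a b) t.
  by apply: differentiableD; apply: differentiableZl.
apply: DeriveDef; first exact/derivable1_diffP.
rewrite deriveE // diffD; [|exact: differentiableZl..].
rewrite [LHS]/= !diffZl //= -!deriveE // !derive_val.
rewrite /ellipse !scalerA addrC; congr (_ *: _ + _ *: _); ring.
Qed.

Lemma ellipse_smooth (c : R) (a b : V) (U : set R^o) :
  smooth_on U (ellipse c a b).
Proof.
have De a' b' (t : R^o) : differentiable (ellipse c a' b') t.
  by apply/derivable1_diffP; have [] := ellipse_is_derive c a' b' t.
move=> k; elim: k a b => [|k IHk] a b /=.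
  by move=> t _; exact: differentiable_continuous.
split=> // v; pose r : R := v.
(* A direction in the line is a scalar, so the differential at [v] is [v] times the derivative along
   1, again an ellipse. *)
rewrite (_ : (fun _ => _) = ellipse c ((r * c) *: b) ((r * - c) *: a)) //.
apply/funext => t; have [_ Det] := ellipse_is_derive c a b t.
rewrite -[v]mulr1 -[v * 1]/(r *: (1 : R^o)) linearZ /= -deriveE // Det.
rewrite /ellipse scalerDr !scalerA; congr (_ *: _ + _ *: _); ring.
Qed.

End Ellipse.

(** * Tangent spaces of the sphere *)

Lemma is_derive_coord (R : realType) m (V : normedModType R)
    (f : V -> 'rV[R]_m) (t u : V) w j :
  is_derive t u f w -> is_derive t u (fun s => f s 0 j) (w 0 j).
Proof.
move=> [df <-]; apply: DeriveDef; first by move/derivable_mxP: (df); apply.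
by rewrite derive_mx // mxE.
Qed.

Section Tangent.
Variables (R : realType) (m q : nat) (M : set 'rV[R]_m).
Implicit Types (F : 'rV[R]_m -> 'rV[R]_q) (x v : 'rV[R]_m).

Lemma smooth_curve_differentiable x (gamma : R^o -> 'rV[R]_m) :
  smooth_curve M x gamma -> differentiable gamma 0.
Proof. by case=> _ [I [_ I0 /(_ 1%N) /= [dg _] _]]; exact: dg. Qed.

(** The chain rule along any curve with velocity [v] forces the value: the differential defined
    through curves is a restriction of the ambient one. *)
Lemma differential_diff F x v w : differentiable F x ->
  differential M F x v w -> w = 'd F x v.
Proof.
move=> dF [gamma gc [<- <-]]; have dg := smooth_curve_differentiable gc.
have g0 : gamma 0 = x by case: gc.
rewrite -g0 in dF *.
rewrite !deriveE //; last exact: differentiable_comp.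
exact: (congr1 (fun h : R^o -> 'rV[R]_q => h 1) (diff_comp dg dF)).
Qed.

Lemma tangent_imageE F x : differentiable F x ->
  tangent_image M F x = 'd F x @` tangent_space M x.
Proof.
move=> dF; apply/seteqP; split=> w.
  by case=> v tv /(differential_diff dF) ->; exists v.
case=> v tv <-; exists v => //; case: (tv) => gamma gc <-.
exists gamma => //; split => //.
have := @differential_diff F x ('D_1 gamma 0) ('D_1 (F \o gamma) 0) dF.
by apply; exists gamma.
Qed.

End Tangent.

Section Sphere.
Variables (R : realType) (m : nat).
Implicit Types (x v w : 'rV[R]_m).

Definition dot x v : R := \sum_i x 0 i * v 0 i.

Definition real_sphere : set 'rV[R]_m := [set x | dot x x = 1].

Lemma dotC x v : dot x v = dot v x.
Proof. by apply: eq_bigr => i _; rewrite mulrC. Qed.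

Lemma dotDZl a x v w : dot (a *: x + v) w = a * dot x w + dot v w.
Proof.
rewrite /dot mulr_sumr -big_split; apply: eq_bigr => i _ /=.
by rewrite !mxE mulrDl mulrA.
Qed.

Lemma dotxx_ge0 x : 0 <= dot x x.
Proof. by apply: sumr_ge0 => i _; rewrite -expr2 sqr_ge0. Qed.

Lemma dotxx_eq0 x : dot x x = 0 -> x = 0.
Proof.
move/eqP; rewrite psumr_eq0 => [/allP h|i _]; last by rewrite -expr2 sqr_ge0.
apply/rowP => i; have := h i (mem_index_enum _).
by rewrite mxE mulf_eq0 orbb => /eqP.
Qed.

Lemma is_derive_dot (V : normedModType R) (f : V -> 'rV[R]_m) t u w :
  is_derive t u f w ->
  is_derive t u (fun s => dot (f s) (f s)) (2 * dot (f t) w).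
Proof.
move=> df.
rewrite (_ : (fun _ => _) =
  \sum_(i < m) ((fun s => f s 0 i) * (fun s => f s 0 i))).
  apply: is_derive_eq.
    apply: is_derive_sum => i; apply: is_deriveM; exact: is_derive_coord.
  rewrite /dot mulr_sumr; apply: eq_bigr => i _.
  by rewrite /GRing.scale /=; ring.
by apply/funext => s; rewrite fct_sumE.
Qed.

(** Along a curve on the sphere, [dot] of the point with itself is constant, and its derivative at 0
    is [2 * dot x v]. Conversely, a nonzero [v] orthogonal to [x] is the velocity of the great
    circle through [x] run at speed |v|. *)
Lemma tangent_real_sphere x v :
  real_sphere x -> tangent_space real_sphere x v <-> dot x v = 0.
Proof.
move=> Sx; split.
  case=> gamma gc <-; have dg := smooth_curve_differentiable gc.
  case: gc => g0 [I [oI I0 _ gI]].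
  have Dg : is_derive (0 : R^o) (1 : R^o) gamma ('D_1 gamma 0).
    by apply: DeriveDef => //; exact: diff_derivable.
  have [_ D1] := is_derive_dot Dg.
  have : 'D_(1 : R^o) (fun s => dot (gamma s) (gamma s)) (0 : R^o) = 0.
    (* The curve is on the sphere only for parameters in [I], so the comparison with the constant 1
       is local at 0. *)
    transitivity ('D_(1 : R^o) (cst (1 : R)) (0 : R^o)); last exact: derive_cst.
    apply: near_eq_derive.
    by near=> t; apply: gI; near: t; apply: open_nbhs_nbhs.
  rewrite D1 g0 => /eqP; rewrite mulf_eq0 pnatr_eq0 /=; exact: eqP.
move=> xv.
(* The great circle divides by the length of [v]; zero velocity is realised by the constant
   curve. *)
have [v0|vn0] := eqVneq v 0.
  exists (cst x); last by rewrite derive_cst.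
  split=> //; exists setT; split=> //; first exact: openT.
  have -> : cst x = ellipse 0 x 0 :> (R^o -> _).
    apply/funext => t.
    by rewrite /ellipse mul0r cos0 sin0 scale1r scaler0 addr0.
  exact: ellipse_smooth.
pose c := Num.sqrt (dot v v).
have cE : c ^+ 2 = dot v v by rewrite sqr_sqrtr ?dotxx_ge0.
have cn0 : c != 0.
  by rewrite -sqrf_eq0 cE; apply: contra_neq vn0; exact: dotxx_eq0.
exists (ellipse c x (c^-1 *: v)).
  split; first by rewrite /ellipse mulr0 cos0 sin0 scale0r scale1r addr0.
  exists setT; split=> //; [exact: openT|exact: ellipse_smooth|move=> t _].
  (* A zero summand is appended so that [dotDZl] expands both terms of the ellipse. *)
  rewrite /real_sphere /= /ellipse scalerA -[_ *: v]addr0.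
  rewrite !(dotDZl, dotC _ (_ *: _ + _)).
  have d0 y : dot 0 y = 0 by rewrite /dot big1 // => i _; rewrite mxE mul0r.
  rewrite (dotC x 0) (dotC v 0) !d0 Sx (dotC v x) xv -cE.
  by rewrite !(mulr0, addr0, add0r) mulr1 -[RHS](cos2Dsin2 (c * t)); field.
have [_ ->] := ellipse_is_derive c x (c^-1 *: v) 0.
rewrite /ellipse mulr0 cos0 sin0 scale0r scale1r addr0.
by rewrite scalerA divff ?scale1r.
Unshelve. all: by end_near. Qed.

Lemma real_sphere_submanifold d : (d + 1)%N = m ->
  smooth_submanifold d real_sphere.
Proof.
move=> dm; exists 1%N => // x Sx.
pose g (y : 'rV[R]_m) : 'rV[R]_1 := const_mx (dot y y - 1).
have pdot : polyfun (fun y : 'rV[R]_m => dot y y).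
  by apply: polyfun_sum => i; apply: polyfunM; apply: polyfun_coord.
have pg : polymap g.
  move=> j; rewrite (_ : (fun _ => _) = (fun y => dot y y) \+ cst (-1)).
    by apply: polyfunD => //; exact: polyfun_cst.
  by apply/funext => y; rewrite mxE.
(* The complement of the origin: there [g] is a submersion, since the derivative of [g] at [y] in
   the radial direction [y] is [2 * dot y y]. *)
exists [set y | 0 < dot y y], g; split.
- rewrite (_ : [set _ | _] = (fun y => dot y y) @^-1` [set r : R | 0 < r]) //.
  apply: open_comp; last exact: open_gt.
  move=> y _; apply: differentiable_continuous.
  exact: polyfun_differentiable.
- by rewrite /= Sx.
- exact: polymap_smooth.
- move=> y _; split=> [Sy|]; first by apply/rowP => j; rewrite !mxE Sy subrr.
  by move/rowP/(_ 0); rewrite !mxE => /eqP; rewrite subr_eq0 => /eqP.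
move=> y /= y0 w; exists ((w 0 0 / (2 * dot y y)) *: y).
have dg := polymap_differentiable y pg.
apply/rowP => j; rewrite ord1 linearZ mxE.
suff -> : 'd g y y 0 0 = 2 * dot y y.
  by rewrite /= divfK // mulf_neq0 ?pnatr_eq0 ?gt_eqF.
rewrite -deriveE //.
have Dg : is_derive y y g ('D_y g y).
  by apply: DeriveDef => //; exact: diff_derivable.
have [_ <-] := is_derive_coord 0 Dg.
have [_ DB] := is_deriveB (is_derive_dot (is_derive_id y y))
  (is_derive_cst (1 : R) y y).
rewrite subr0 in DB.
rewrite (_ : (fun s => g s 0 0) = (fun s => dot s s) - cst 1); first exact: DB.
by apply/funext => z; rewrite mxE.
Qed.

End Sphere.

(** * Complex-valued functions *)

Section ComplexValued.
Variable R : realType.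
Local Notation C := R[i].

Lemma complex_ReD (a b : C) : complex.Re (a + b) = complex.Re a + complex.Re b.
Proof. exact: raddfD. Qed.

Lemma complex_ImD (a b : C) : complex.Im (a + b) = complex.Im a + complex.Im b.
Proof. exact: raddfD. Qed.

Lemma complex_ReM (a b : C) : complex.Re (a * b) =
  complex.Re a * complex.Re b - complex.Im a * complex.Im b.
Proof. by case: a b => [? ?] [? ?]. Qed.

Lemma complex_ImM (a b : C) : complex.Im (a * b) =
  complex.Re a * complex.Im b + complex.Im a * complex.Re b.
Proof. by case: a b => [? ?] [? ?]. Qed.

Lemma complex_Re_conj (a : C) : complex.Re a^* = complex.Re a.
Proof. by case: a. Qed.

Lemma complex_Im_conj (a : C) : complex.Im a^* = - complex.Im a.
Proof. by case: a. Qed.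

Section Deriv.
Variables (V : normedModType R) (x v : V).

(** A derivative along a real direction, hence compatible with conjugation: polynomials in z and its
    conjugate are differentiated by the sum and product rules alone. *)
Definition is_cderive (f : V -> C) (d : C) : Prop :=
  is_derive x v (fun y => complex.Re (f y)) (complex.Re d) /\
  is_derive x v (fun y => complex.Im (f y)) (complex.Im d).

Lemma is_cderive_cst c : is_cderive (cst c) 0.
Proof. by split; exact: is_derive_cst. Qed.

Lemma is_cderiveD f g df dg : is_cderive f df -> is_cderive g dg ->
  is_cderive (fun y => f y + g y) (df + dg).
Proof.
move=> [f1 f2] [g1 g2]; split.
  under eq_fun do rewrite complex_ReD.
  by rewrite complex_ReD; exact: is_deriveD.
under eq_fun do rewrite complex_ImD.
by rewrite complex_ImD; exact: is_deriveD.
Qed.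

Lemma is_cderiveM f g df dg : is_cderive f df -> is_cderive g dg ->
  is_cderive (fun y => f y * g y) (df * g x + f x * dg).
Proof.
move=> [f1 f2] [g1 g2]; split.
  have := is_deriveB (is_deriveM f1 g1) (is_deriveM f2 g2).
  congr is_derive; first by apply/funext => y; rewrite complex_ReM.
  by rewrite complex_ReD !complex_ReM /GRing.scale /=; ring.
have := is_deriveD (is_deriveM f1 g2) (is_deriveM f2 g1).
congr is_derive; first by apply/funext => y; rewrite complex_ImM.
by rewrite complex_ImD !complex_ImM /GRing.scale /=; ring.
Qed.

Lemma is_cderive_conj f df : is_cderive f df ->
  is_cderive (fun y => (f y)^*) (df^*).
Proof.
move=> [f1 f2]; split.
  by under eq_fun do rewrite complex_Re_conj; rewrite complex_Re_conj.
under eq_fun do rewrite complex_Im_conj.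
by rewrite complex_Im_conj; exact: is_deriveN.
Qed.

Lemma is_cderive_sum n (f : 'I_n -> V -> C) (d : 'I_n -> C) :
  (forall i, is_cderive (f i) (d i)) ->
  is_cderive (fun y => \sum_i f i y) (\sum_i d i).
Proof.
move=> fd; have := fd; elim: n f d {fd} => [|n IHn] f d fd.
  rewrite big_ord0 (_ : (fun _ => _) = cst 0); first exact: is_cderive_cst.
  by apply/funext => y; rewrite big_ord0.
rewrite big_ord_recr (_ : (fun _ => _) =
   fun y => \sum_(i < n) f (widen_ord (leqnSn n) i) y + f ord_max y).
  by apply: is_cderiveD => //; apply: IHn.
by apply/funext => y; rewrite big_ord_recr.
Qed.

End Deriv.

Lemma is_cderive_complexify N (x v : 'rV[R]_(N + N)) j :
  is_cderive x v (fun y => complexify y 0 j) (complexify v 0 j).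
Proof.
split.
  rewrite (_ : (fun _ => _) = (fun y : 'rV[R]_(N + N) => y 0 (lshift N j))).
    by rewrite !mxE /=; apply: is_derive_coord; exact: is_derive_id.
  by apply/funext => y; rewrite !mxE.
rewrite (_ : (fun _ => _) = (fun y : 'rV[R]_(N + N) => y 0 (rshift N j))).
  by rewrite !mxE /=; apply: is_derive_coord; exact: is_derive_id.
by apply/funext => y; rewrite !mxE.
Qed.

Section Poly.
Variable m : nat.
Implicit Types f g : 'rV[R]_m -> C.

Definition cpolyfun f : Prop :=
  polyfun (fun y => complex.Re (f y)) /\ polyfun (fun y => complex.Im (f y)).

Lemma cpolyfun_cst c : cpolyfun (cst c).
Proof. by split; exact: polyfun_cst. Qed.

Lemma cpolyfunD f g : cpolyfun f -> cpolyfun g -> cpolyfun (fun y => f y + g y).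
Proof.
move=> [f1 f2] [g1 g2]; split.
  by under eq_fun do rewrite complex_ReD; exact: polyfunD.
by under eq_fun do rewrite complex_ImD; exact: polyfunD.
Qed.

Lemma cpolyfunM f g : cpolyfun f -> cpolyfun g -> cpolyfun (fun y => f y * g y).
Proof.
move=> [f1 f2] [g1 g2]; split.
  under eq_fun do rewrite complex_ReM.
  exact: polyfunD (polyfunM f1 g1) (polyfunN (polyfunM f2 g2)).
under eq_fun do rewrite complex_ImM.
exact: polyfunD (polyfunM f1 g2) (polyfunM f2 g1).
Qed.

Lemma cpolyfun_conj f : cpolyfun f -> cpolyfun (fun y => (f y)^*).
Proof.
move=> [f1 f2]; split; first by under eq_fun do rewrite complex_Re_conj.
by under eq_fun do rewrite complex_Im_conj; exact: polyfunN.
Qed.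

Lemma cpolyfun_sum n (f : 'I_n -> 'rV[R]_m -> C) :
  (forall i, cpolyfun (f i)) -> cpolyfun (fun y => \sum_i f i y).
Proof.
elim: n f => [|n IHn] f pf.
  rewrite (_ : (fun _ => _) = cst 0); first exact: cpolyfun_cst.
  by apply/funext => y; rewrite big_ord0.
rewrite (_ : (fun _ => _) =
   fun y => \sum_(i < n) f (widen_ord (leqnSn n) i) y + f ord_max y).
  by apply: cpolyfunD => //; apply: IHn.
by apply/funext => y; rewrite big_ord_recr.
Qed.

Lemma polymap_realify q (F : 'rV[R]_m -> 'rV[C]_q) :
  (forall j, cpolyfun (fun y => F y 0 j)) -> polymap (@realify R q \o F).
Proof.
move=> pF j; case: (split_ordP j) => k ->; have [p1 p2] := pF k.
  by move: p1; congr polyfun; apply/funext => y; rewrite /= row_mxEl mxE.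
by move: p2; congr polyfun; apply/funext => y; rewrite /= row_mxEr mxE.
Qed.

Lemma complexify_diff q (F : 'rV[R]_m -> 'rV[C]_q) x v (d : 'rV[C]_q) :
  differentiable (@realify R q \o F) x ->
  (forall j, is_cderive x v (fun y => F y 0 j) (d 0 j)) ->
  complexify ('d (@realify R q \o F) x v) = d.
Proof.
move=> dF Fd; rewrite -deriveE //.
have DF : is_derive x v (@realify R q \o F) ('D_v (@realify R q \o F) x).
  by apply: DeriveDef => //; exact: diff_derivable.
apply/rowP => j; rewrite !mxE; have [[_ d1] [_ d2]] := Fd j.
have [_ <-] := is_derive_coord (lshift q j) DF.
have [_ <-] := is_derive_coord (rshift q j) DF.
rewrite (_ : (fun _ => _) = fun y => complex.Re (F y 0 j)); last first.
  by apply/funext => y; rewrite /= row_mxEl mxE.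
rewrite (_ : (fun y => (@realify R q \o F) y _ _) =
  fun y => complex.Im (F y 0 j)); last first.
  by apply/funext => y; rewrite /= row_mxEr mxE.
by rewrite d1 d2; case: (d 0 j).
Qed.

End Poly.

Lemma cpolyfun_complexify N j :
  cpolyfun (fun y : 'rV[R]_(N + N) => complexify y 0 j).
Proof.
split.
  rewrite (_ : (fun _ => _) = (fun y : 'rV[R]_(N + N) => y 0 (lshift N j))).
    exact: polyfun_coord.
  by apply/funext => y; rewrite !mxE.
rewrite (_ : (fun _ => _) = (fun y : 'rV[R]_(N + N) => y 0 (rshift N j))).
  exact: polyfun_coord.
by apply/funext => y; rewrite !mxE.
Qed.

(** * The unit sphere in complex and in real coordinates *)

Lemma dot_realify N (z u : 'rV[C]_N) :
  dot (realify z) (realify u) = complex.Re (\sum_j (z 0 j)^* * u 0 j).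
Proof.
rewrite /dot big_split_ord /= -big_split /= raddf_sum; apply: eq_bigr => j _ /=.
rewrite !row_mxEl !row_mxEr !mxE; case: (z 0 j) (u 0 j) => [? ?] [? ?] /=; ring.
Qed.

Lemma realify_unit_sphere N :
  @realify R N @` @unit_sphere R N = @real_sphere R (N + N).
Proof.
have E (z : 'rV[C]_N) :
    \sum_j `|z 0 j| ^+ 2 = (dot (realify z) (realify z))%:C%C.
  have -> : \sum_j `|z 0 j| ^+ 2 = \sum_j (z 0 j)^* * z 0 j.
    by apply: eq_bigr => j _; rewrite normCK mulrC.
  rewrite dot_realify; apply/esym/eqP; rewrite eq_complex /= eqxx /= eq_sym.
  rewrite raddf_sum /= big1 // => j _.
  by case: (z 0 j) => a b /=; ring.
apply/seteqP; split=> x /=.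
  case=> z; rewrite /unit_sphere /= E => /eqP + <-.
  by rewrite eq_complex => /andP[/eqP /= ? _].
rewrite /real_sphere /= => Sx; exists (complexify x); last exact: complexifyK.
by rewrite /unit_sphere /= E complexifyK Sx.
Qed.

End ComplexValued.

(** * Linear algebra: the graph of a linear form over a common kernel *)

(** The pair (f1, f2) is onto a plane, so by rank-nullity its kernel has codimension 2; the graph
    map u -> (u, g u) is injective and preserves the dimension of that kernel. *)
Lemma graph_ker_dim (K : fieldType) N (f1 f2 g : {linear 'rV[K]_N -> K^o}) :
  (forall p q, exists u, f1 u = p /\ f2 u = q) ->
  exists2 V : {vspace 'rV[K]_(N + 1)},
    (forall w, w \in V <->
      exists u, [/\ f1 u = 0, f2 u = 0 & w = row_mx u (const_mx (g u))]) &
    \dim V = (N - 2)%N.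
Proof.
move=> surj.
pose f u : 'rV[K]_(1 + 1) := row_mx (const_mx (f1 u)) (const_mx (f2 u)).
have lf : linear f.
  move=> a u v; rewrite /f !linearP /= scale_row_mx add_row_mx.
  by congr row_mx; apply/rowP => j; rewrite !mxE.
pose fL := HB.pack_for {linear 'rV[K]_N -> 'rV[K]_(1 + 1)} f
  (GRing.isLinear.Build _ _ _ _ f lf).
pose h u : 'rV[K]_(N + 1) := row_mx u (const_mx (g u)).
have lh : linear h.
  move=> a u v; rewrite /h linearP /= scale_row_mx add_row_mx.
  by congr row_mx; apply/rowP => j; rewrite !mxE.
pose hL := HB.pack_for {linear 'rV[K]_N -> 'rV[K]_(N + 1)} h
  (GRing.isLinear.Build _ _ _ _ h lh).
pose F := linfun fL; pose H := linfun hL.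
have kerF u : (u \in lker F) = (f1 u == 0) && (f2 u == 0).
  rewrite memv_ker lfunE /= /f -row_mx0; apply/eqP/andP.
    by move=> /eq_row_mx [/rowP/(_ 0) + /rowP/(_ 0)]; rewrite !mxE => -> ->.
  by move=> [/eqP -> /eqP ->]; congr row_mx; apply/rowP => j; rewrite !mxE.
exists (H @: lker F)%VS => [w|].
  split=> [/memv_imgP[u]|[u [f1u f2u ->]]].
    by rewrite kerF => /andP[/eqP ? /eqP ?] ->; exists u; rewrite lfunE.
  by apply/memv_imgP; exists u; rewrite ?lfunE // kerF f1u f2u eqxx.
have kerH : lker H = 0%VS.
  apply/eqP; rewrite -subv0; apply/subvP => u.
  by rewrite memv_ker lfunE /= /h memv0 -row_mx0 => /eqP/eq_row_mx[-> _].
rewrite limg_dim_eq ?kerH ?capv0 //.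
have := limg_ker_dim F fullv; rewrite capfv.
have -> : (F @: fullv = fullv)%VS.
  apply/eqP; rewrite eqEsubv subvf; apply/subvP => w _; apply/memv_imgP.
  have [u [f1u f2u]] := surj (w 0 (lshift 1 0)) (w 0 (rshift 1 0)).
  exists u; rewrite ?memvf // lfunE /= /f f1u f2u -[LHS]hsubmxK.
  by congr row_mx; apply/rowP => j; rewrite !mxE ord1.
(* Rank-nullity reads dim ker + 2 = N, so the truncated subtraction [N - 2] is exact. *)
rewrite !dimvf !dim_matrix; rewrite !mul1r => dimN; lia.
Qed.

(** * The derivative of the graph of Q *)

Section GraphOfQ.
Variables (R : realType) (n : nat).
Local Notation C := R[i].
Local Notation e0 k := (Ordinal (fst_index_subproof k)).
Local Notation e1 k := (Ordinal (snd_index_subproof k)).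
Implicit Types (x y : C) (z u : 'rV[C]_(2 * n)).

(* The Wirtinger derivatives of P with respect to xbar and ybar. *)
Definition P_xbar x y : C := y^* * (y * y^* + 2 * 'i * x * x^*).
Definition P_ybar x y : C := x^* * (2 * y * y^* + 'i * x * x^*).

(** If the real part 2ab - b^2 and the imaginary part a^2 - 2ab both vanish, then a^2 = b^2, hence a
    = b because both are nonnegative, and the real part becomes a^2 = 0. *)
Lemma P_bar_independent x y : (x != 0) || (y != 0) ->
  x * P_ybar x y - y * P_xbar x y != 0.
Proof.
have sqE (w : C) : w * w^* = (complex.Re w ^+ 2 + complex.Im w ^+ 2)%:C%C.
  by case: w => a b; apply/eqP; rewrite eq_complex /=; apply/andP; split;
    apply/eqP; ring.
have sq0 (w : C) : complex.Re w ^+ 2 + complex.Im w ^+ 2 = 0 -> w = 0.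
  move=> w0; apply/eqP; rewrite -normr_eq0 -sqrf_eq0 normCK sqE w0.
  by rewrite -[0%:C%C]/(0 : C).
apply: contraTneq => Deq0; rewrite negb_or !negbK.
set a := complex.Re x ^+ 2 + complex.Im x ^+ 2 in sqE *.
set b := complex.Re y ^+ 2 + complex.Im y ^+ 2 in sqE *.
have : x * P_ybar x y - y * P_xbar x y =
    ((2 * a * b - b ^+ 2) +i* (a ^+ 2 - 2 * a * b))%C.
  transitivity (x * x^* * (2 * (y * y^*) + 'i * (x * x^*))
     - y * y^* * (y * y^* + 2 * 'i * (x * x^*))).
    by rewrite /P_xbar /P_ybar; ring.
  rewrite !sqE -/a -/b -complexiE.
  by apply/eqP; rewrite eq_complex /=; apply/andP; split; apply/eqP; ring.
rewrite Deq0 => ab; have /= h1 := congr1 (@complex.Re R) ab.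
have /= h2 := congr1 (@complex.Im R) ab.
have a0 : 0 <= a by rewrite addr_ge0 ?sqr_ge0.
have b0 : 0 <= b by rewrite addr_ge0 ?sqr_ge0.
have /eqP : a ^+ 2 = b ^+ 2 by lra.
rewrite eqrXn2 // => /eqP eab; rewrite -eab in h1.
have /eqP : a ^+ 2 = 0 by lra.
rewrite sqrf_eq0 => /eqP a00; move: (a00); rewrite eab.
by move: a00 => /sq0 -> /sq0 ->; rewrite eqxx.
Qed.

Definition herm z u : C := \sum_j (z 0 j)^* * u 0 j.

(* The C-linear part of the differential of Q at z. *)
Definition dQ z u : C := \sum_(k < n)
  ('i * (z 0 (e0 k))^* ^+ 2 * (z 0 (e1 k))^* * u 0 (e0 k) +
   (z 0 (e0 k))^* * (z 0 (e1 k))^* ^+ 2 * u 0 (e1 k)).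

(* The complex conjugate of the C-antilinear part of the differential of Q at z,
   which is C-linear in u. *)
Definition dbarQ_conj z u : C := \sum_(k < n)
  ((P_xbar (z 0 (e0 k)) (z 0 (e1 k)))^* * u 0 (e0 k) +
   (P_ybar (z 0 (e0 k)) (z 0 (e1 k)))^* * u 0 (e1 k)).

Lemma herm_linear z : linear (herm z : _ -> C^o).
Proof.
move=> a u v; rewrite /herm scaler_sumr -big_split; apply: eq_bigr => j _.
by rewrite !mxE /GRing.scale /=; ring.
Qed.

HB.instance Definition _ z := GRing.isLinear.Build C 'rV[C]_(2 * n) C^o *:%R
  (herm z) (@herm_linear z).

Lemma dQ_linear z : linear (dQ z : _ -> C^o).
Proof.
move=> a u v; rewrite /dQ scaler_sumr -big_split; apply: eq_bigr => j _.
by rewrite !mxE /GRing.scale /=; ring.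
Qed.

HB.instance Definition _ z := GRing.isLinear.Build C 'rV[C]_(2 * n) C^o *:%R
  (dQ z) (@dQ_linear z).

Lemma dbarQ_conj_linear z : linear (dbarQ_conj z : _ -> C^o).
Proof.
move=> a u v; rewrite /dbarQ_conj scaler_sumr -big_split; apply: eq_bigr => j _.
by rewrite !mxE /GRing.scale /=; ring.
Qed.

HB.instance Definition _ z := GRing.isLinear.Build C 'rV[C]_(2 * n) C^o *:%R
  (dbarQ_conj z) (@dbarQ_conj_linear z).

Lemma sum_mul_delta (I : finType) (c : I -> C) (i : I) (a : C) :
  \sum_j c j * (a * (j == i)%:R) = c i * a.
Proof.
rewrite (bigD1 i) //= eqxx mulr1 big1 ?addr0 // => j /negPf ->.
by rewrite mulr0 mulr0.
Qed.

(* The vector u is supported on one pair of coordinates at which z does not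
   vanish. *)
Lemma herm_dbarQ_surj z : z != 0 ->
  forall p q, exists u, herm z u = p /\ dbarQ_conj z u = q.
Proof.
move=> zn0 p q.
have [k xy0] : exists k, (z 0 (e0 k) != 0) || (z 0 (e1 k) != 0).
  apply/existsP; apply: contraNT zn0 => /existsPn z0.
  apply/eqP/rowP => j; rewrite mxE.
  (* Coordinate [j] lies in the pair of index j/2, as its second entry exactly when [j] is odd; if
     all pairs vanish, so does [z]. *)
  have jn : (j./2 < n)%N by have := ltn_ord j; lia.
  have := z0 (Ordinal jn); rewrite negb_or !negbK => /andP[/eqP z0k /eqP z1k].
  have [jo|je] := boolP (odd j).
    by rewrite -z1k; congr (z 0 _); apply/val_inj => /=; lia.
  by rewrite -z0k; congr (z 0 _); apply/val_inj => /=; lia.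
pose A := (P_xbar (z 0 (e0 k)) (z 0 (e1 k)))^*.
pose B := (P_ybar (z 0 (e0 k)) (z 0 (e1 k)))^*.
pose X := (z 0 (e0 k))^*; pose Y := (z 0 (e1 k))^*.
(* This is the conjugate of the determinant in [P_bar_independent]. *)
have D0 : X * B - Y * A != 0.
  by rewrite -!rmorphM -rmorphB fmorph_eq0 P_bar_independent.
(* Cramer's rule for X al + Y be = p and A al + B be = q. *)
pose al := (p * B - q * Y) / (X * B - Y * A).
pose be := (X * q - A * p) / (X * B - Y * A).
pose u : 'rV[C]_(2 * n) := \row_j (al * (j == e0 k)%:R + be * (j == e1 k)%:R).
have u0 k' : u 0 (e0 k') = al * (k' == k)%:R.
  have E : (e0 k' == e0 k) = (k' == k) by rewrite -!val_eqE /=; lia.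
  have E' : (e0 k' == e1 k) = false by rewrite -!val_eqE /=; lia.
  by rewrite mxE E E' mulr0 addr0.
have u1 k' : u 0 (e1 k') = be * (k' == k)%:R.
  have E : (e1 k' == e1 k) = (k' == k) by rewrite -!val_eqE /=; lia.
  have E' : (e1 k' == e0 k) = false by rewrite -!val_eqE /=; lia.
  by rewrite mxE E E' mulr0 add0r.
exists u; split.
  rewrite /herm; under eq_bigr do rewrite mxE mulrDr.
  by rewrite big_split /= !sum_mul_delta -/X -/Y /al /be; field.
rewrite /dbarQ_conj big_split /=.
under eq_bigr do rewrite u0; under [X in _ + X]eq_bigr do rewrite u1.
rewrite !(sum_mul_delta (fun k => (_ (z 0 (e0 k)) (z 0 (e1 k)))^*)).
by rewrite -/A -/B /al /be; field.
Qed.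

Local Notation N := (2 * n)%N.
Local Notation F := (@graphQ R n \o @complexify R N).
Local Notation RF := (@realify R (N + 1) \o F).
Implicit Types (s v : 'rV[R]_(N + N)).

Lemma polymap_graphQ : polymap RF.
Proof.
apply: polymap_realify => j; case: (split_ordP j) => k ->.
  under eq_fun do rewrite /= /graphQ row_mxEl; exact: cpolyfun_complexify.
under eq_fun do rewrite /= /graphQ row_mxEr mxE /Q.
apply: cpolyfun_sum => {}k; rewrite /P.
under eq_fun do rewrite !expr2.
do ?[apply: cpolyfunD|apply: cpolyfunM|apply: cpolyfun_conj
  |exact: cpolyfun_complexify|exact: cpolyfun_cst].
Qed.

(** The first coordinates are linear. In the last one the product rule applied to each [P] gives
    terms in u, collected in [dQ], and terms in the conjugate of u, collected in the conjugate of
    [dbarQ_conj]. *)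
Lemma complexify_diff_graphQ s v : complexify ('d RF s v) =
  row_mx (complexify v)
    (const_mx (dQ (complexify s) (complexify v)
               + (dbarQ_conj (complexify s) (complexify v))^*)).
Proof.
apply: complexify_diff; first exact: polymap_differentiable polymap_graphQ.
move=> j; case: (split_ordP j) => k ->.
  under eq_fun do rewrite /= /graphQ row_mxEl.
  rewrite row_mxEl; exact: is_cderive_complexify.
under eq_fun do rewrite /= /graphQ row_mxEr mxE /Q.
rewrite row_mxEr mxE /dQ /dbarQ_conj rmorph_sum -big_split.
apply: is_cderive_sum => {}k; rewrite /P.
under eq_fun do rewrite !expr2.
have H0 := is_cderive_complexify s v (e0 k).
have H1 := is_cderive_complexify s v (e1 k).
have C0 := is_cderive_conj H0; have C1 := is_cderive_conj H1.
have := is_cderiveD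
  (is_cderiveM (is_cderiveM H1 C0) (is_cderiveM C1 C1))
  (is_cderiveM (is_cderiveM (is_cderiveM (is_cderive_cst s v 'i) H0)
     (is_cderiveM C0 C0)) C1).
congr is_cderive.
by rewrite /P_xbar /P_ybar rmorphD !rmorphM /= !conjCK; ring.
Qed.

End GraphOfQ.

(** * The maximal complex subspace *)

Section Main.
Variables (R : realType) (n : nat).
Local Notation C := R[i].
Local Notation N := (2 * n)%N.
Local Notation F := (@graphQ R n \o @complexify R N).
Local Notation RF := (@realify R (N + 1) \o F).
Local Notation S := (@real_sphere R (N + N)).

Lemma tangent_real_sphere_herm s v : S s ->
  tangent_space S s v <-> complex.Re (herm (complexify s) (complexify v)) = 0.
Proof.
move=> Ss; rewrite tangent_real_sphere // -dot_realify.
by rewrite !complexifyK.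
Qed.

Lemma complex_tangent_imageE s : S s ->
  complex_tangent_image S F s =
  [set w | exists2 u, complex.Re (herm (complexify s) u) = 0 &
     w = row_mx u (const_mx (dQ (complexify s) u
                             + (dbarQ_conj (complexify s) u)^*))].
Proof.
move=> Ss; rewrite /complex_tangent_image tangent_imageE; last first.
  exact: polymap_differentiable (@polymap_graphQ R n).
apply/seteqP; split=> w.
  case=> _ [v /(tangent_real_sphere_herm _ Ss) hv <-] <-.
  by exists (complexify v) => //; exact: complexify_diff_graphQ.
case=> u hu ->; exists ('d RF s (realify u)).
  exists (realify u) => //.
  by apply/tangent_real_sphere_herm; rewrite ?realifyK.
by rewrite complexify_diff_graphQ realifyK.
Qed.

(** A common point is over u = i u' with [u] and [u'] both tangent. Multiplication by i commutes
    with [dQ] but changes sign through the antilinear part, which must therefore vanish; Re <z, u'>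
    = Re <z, i u'> = 0 gives <z, u'> = 0. *)
Lemma complex_tangent_image_capJ s : S s -> forall w,
  (complex_tangent_image S F s `&`
     (@J R (N + 1) @` complex_tangent_image S F s)) w <->
  exists u, [/\ herm (complexify s) u = 0, dbarQ_conj (complexify s) u = 0 &
     w = row_mx u (const_mx (dQ (complexify s) u))].
Proof.
move=> Ss w; rewrite complex_tangent_imageE //; set z := complexify s.
have hermZ c u : herm z (c *: u) = c * herm z u by rewrite linearZ.
have dQZ c u : dQ z (c *: u) = c * dQ z u by rewrite linearZ.
have dbZ c u : dbarQ_conj z (c *: u) = c * dbarQ_conj z u by rewrite linearZ.
have Rei (c : C) : complex.Re ('i * c) = - complex.Im c.
  by rewrite -complexiE complex_ReM /= mul0r mul1r sub0r.
split.
  case=> -[u hu ->] [_ [u' hu' ->]].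
  rewrite /J scale_row_mx => /eq_row_mx [uE /rowP/(_ 0)].
  (* After the [dQ] terms cancel, the antilinear part c satisfies i c = - i c, so c = 0. *)
  rewrite !mxE -uE dQZ dbZ rmorphM /= conjCi mulrDr => /addrI /eqP.
  rewrite mulNr -addr_eq0 -mulr2n mulrn_eq0 /= mulf_eq0 (negPf (neq0Ci _)) /=.
  rewrite conjC_eq0 => /eqP db0.
  have h0 : herm z u' = 0.
    apply/eqP; rewrite eq_complex hu' eqxx /= -oppr_eq0 -Rei -hermZ uE.
    by rewrite hu.
  exists ('i *: u'); rewrite hermZ dbZ h0 db0 !mulr0; split=> //.
  by rewrite dQZ conjC0 mulr0 subr0.
case=> u [h0 db0 ->]; split.
  by exists u; rewrite ?h0 // db0 conjC0 addr0.
(* The preimage under [J] is -i times the given vector, which satisfies the same complex linear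
   equations. *)
exists (row_mx (- 'i *: u) (const_mx (dQ z (- 'i *: u)))).
  by exists (- 'i *: u); rewrite ?hermZ ?dbZ ?h0 ?db0 mulr0 ?conjC0 ?addr0.
have iZ : 'i * - 'i = 1 :> C by rewrite mulrN -expr2 sqrCi opprK.
rewrite /J scale_row_mx scalerA iZ scale1r; congr row_mx.
by apply/rowP => j; rewrite !mxE dQZ mulrA iZ mul1r.
Qed.

End Main.

(** * CR regularity of the graph of [Q] over the sphere *)

Theorem theorem1p2 (R : realType) (n : nat) (hn : (1 <= n)%N) :
  CR_regular_embedding (4 * n - 1)%N
    (@realify R (2 * n) @` @unit_sphere R (2 * n))
    (@graphQ R n \o @complexify R (2 * n)).
Proof.
rewrite realify_unit_sphere.
have pF := @polymap_graphQ R n.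
(* The first 2n complex coordinates of dF(v) are [v] itself, so dF is injective. *)
have cF (s v : 'rV[R]_(2 * n + 2 * n)) :=
  congr1 lsubmx (complexify_diff_graphQ s v).
split.
(* Since n >= 1, the truncated 4n - 1 is one less than the real dimension 2n + 2n. *)
- by apply: real_sphere_submanifold; lia.
- split.
  + move=> s _; exists setT; eexists; split; last by move=> y _ _; reflexivity.
    * exact: openT.
    * by [].
    * exact: polymap_smooth.
  + move=> s v _ _ /(differential_diff (polymap_differentiable s pF)) d0.
    have := cF s v; rewrite -d0 row_mxKl => cv0.
    rewrite -(complexifyK v) -cv0.
    by apply/rowP => j; case: (split_ordP j) => k ->;
      rewrite ?row_mxEl ?row_mxEr !mxE.
  (* The inverse on the image forgets the last coordinate; it is polynomial, hence continuous
     everywhere. *)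
  + pose G := @realify R (2 * n) \o
      (fun y : 'rV[R]_(2 * n + 1 + (2 * n + 1)) => lsubmx (complexify y)).
    exists G; last first.
      by move=> s _; rewrite /G /= realifyK /graphQ row_mxKl complexifyK.
    have pG : polymap G.
      apply: polymap_realify => j; under eq_fun do rewrite mxE.
      exact: cpolyfun_complexify.
    apply: continuous_subspaceT => y.
    by apply: differentiable_continuous; exact: polymap_differentiable.
(* (4n - 1) - (2n + 1) = 2n - 2, which is nonnegative because n >= 1. *)
move=> s Ss T; exists (2 * n - 2)%N; last by lia.
have zn0 : complexify s != 0.
  apply/eqP => z0; have : dot s s = 0.
    rewrite -[s]complexifyK z0 dot_realify big1 // => j _.
    by rewrite mxE mulr0.
  by rewrite [dot s s]Ss => /eqP; rewrite oner_eq0.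
have [V Vw dV] := graph_ker_dim (dQ (complexify s)) (herm_dbarQ_surj zn0).
exists V => //; apply/seteqP; split=> w /=.
  by move/(complex_tangent_image_capJ Ss) => h; apply/Vw.
by move/Vw => h; apply/(complex_tangent_image_capJ Ss).
Qed.
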